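(* Let $X$ be a complete metric space and $w_1,\ldots,w_N:X\to X$ be contracting homeomorphisms of $X$ onto $X$. Assume that every point in the attractor $A$ of this system has a finite number of addresses. Then $(w_1,\ldots,w_N)\in\bigcap_{n=1}^{\infty}\mathcal V_n$, or equivalently, the system $(w_1,\ldots,w_N)$ satisfies the strong Markov property (SMP).
   Context: $\mathbb N=\{1,2,\ldots\}$, $N\in\mathbb N$, and $d$ is the distance in $X$. A mapping $w:X\to X$ is contracting if $\sigma(w)=\sup_{x\neq y\in X}\frac{d(w(x),w(y))}{d(x,y)}<1$. $\mathcal M(X)$ denotes the set of all contracting homeomorphisms of $X$ onto itself. For $(w_1,\ldots,w_N)\in(\mathcal M(X))^N$, the attractor $A=A(w_1,\ldots,w_N)$ is the unique non-empty compact subset of $X$ with $A=\bigcup_{i=1}^N w_i(A)$. Let $\Sigma=\{1,\ldots,N\}$, and for $\mathbf i=(i_1,\ldots,i_n)\in\Sigma^n$ let $w_{\mathbf i}=w_{i_1,\ldots,i_n}=w_{i_1}\circ\cdots\circ w_{i_n}$. $\Sigma^\infty$ is the set of all infinite sequences with entries in $\Sigma$. A sequence $(i_1,i_2,\ldots)\in\Sigma^\infty$ is called an address of a point $x\in A$ if $x\in\bigcap_{n=1}^\infty w_{i_1,\ldots,i_n}(A)$. For $n\in\mathbb N$, $\mathcal V_n$ is the set of all ordered $N$-tuples $(w_1,\ldots,w_N)\in(\mathcal M(X))^N$ such that for every $\mathbf i\in\Sigma^n$, $w_{\mathbf i}(A)\nsubseteq\bigcup_{\mathbf j\in\Sigma^n,\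 \mathbf j\neq\mathbf i}w_{\mathbf j}(A)$. The system satisfies the strong Markov property (SMP) if for every $n\in\mathbb N$ there is an open set $\mathcal O_n\subset X$ such that (1) $\overline{\mathcal O_n\cap A}=A$; and (2) $w_{\mathbf i}(\mathcal O_n)\cap w_{\mathbf j}(\mathcal O_n)=\emptyset$ for all $\mathbf i\neq\mathbf j\in\Sigma^n$. *)

(* Defs.v *)
From HB Require Import structures.
From mathcomp Require Import all_boot all_order all_algebra.
From mathcomp Require Import all_classical all_reals all_analysis.

Set Implicit Arguments.
Unset Strict Implicit.
Unset Printing Implicit Defensive.

Local Open Scope classical_set_scope.
Local Open Scope ring_scope.

(* The join of the library's metric and complete structures. [Complete] includes
   [isPointed], so these spaces are non-empty; attractors exist only then. *)
#[short(type="completeMetricType")]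
HB.structure Definition CompleteMetric (R : numDomainType) :=
  {T of Metric R T & Complete T}.

Section IFS.
Context {R : realType} {X : completeMetricType R}.

(* The supremum is taken in the extended reals: it is +oo for a map that is not
   Lipschitz, and -oo when X is a singleton. *)
Definition contraction_ratio (w : X -> X) : \bar R :=
  ereal_sup [set (mdist (w p.1) (w p.2) / mdist p.1 p.2)%:E
            | p in [set p : X * X | p.1 != p.2]].

Definition contracting (w : X -> X) : Prop := (contraction_ratio w < 1)%E.

Definition homeomorphism (w : X -> X) : Prop :=
  exists v : X -> X,
    [/\ cancel w v, cancel v w, continuous w & continuous v].

Definition contracting_homeo : set (X -> X) :=
  [set w | contracting w /\ homeomorphism w].

Definition is_attractor (N : nat) (w : 'I_N -> X -> X) (A : set X) : Prop :=
  [/\ A !=set0, compact A & A = \bigcup_(i : 'I_N) (w i @` A)].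

(* By Hutchinson's theorem, exactly one set satisfies [is_attractor w] when
   N > 0 and all w i are contracting; the default [set0] is then irrelevant. *)
Definition attractor (N : nat) (w : 'I_N -> X -> X) : set X :=
  xget set0 [set A | is_attractor w A].

(* w_(i_1,...,i_n) = w_(i_1) \o ... \o w_(i_n): the first letter is outermost. *)
Definition word_map (N : nat) (w : 'I_N -> X -> X) (i : seq 'I_N) : X -> X :=
  foldr (fun k f => w k \o f) id i.

(* Infinite sequences are indexed from 0; [mkseq s n] lists the first n entries. *)
Definition is_address (N : nat) (w : 'I_N -> X -> X) (s : nat -> 'I_N) (x : X)
    : Prop :=
  (\bigcap_(n in [set n | (0 < n)%N])
     (word_map w (mkseq s n) @` attractor w)) x.

Definition addresses (N : nat) (w : 'I_N -> X -> X) (x : X)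
    : set (nat -> 'I_N) :=
  [set s | is_address w s x].

Definition Vset {N : nat} (n : nat) : set ('I_N -> X -> X) :=
  [set w | (forall k, contracting_homeo (w k)) /\
    forall i : n.-tuple 'I_N,
      ~ (word_map w i @` attractor w `<=`
         \bigcup_(j in [set j : n.-tuple 'I_N | j != i])
            (word_map w j @` attractor w))].

Definition strong_Markov_property (N : nat) (w : 'I_N -> X -> X) : Prop :=
  forall n : nat, (0 < n)%N ->
    exists U : set X,
      [/\ open U,
          closure (U `&` attractor w) = attractor w &
          forall i j : n.-tuple 'I_N, i != j ->
            (word_map w i @` U) `&` (word_map w j @` U) = set0].

End IFS.

(* Main.v *)
Require Import Defs.
From mathcomp Require Import all_boot all_order all_algebra.
From mathcomp Require Import all_classical all_reals all_analysis.
From mathcomp Require Import ring lra.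

Import Order.TTheory GRing.Theory Num.Theory.
Import metricType_numDomainType numFieldNormedType.Exports.

Local Open Scope classical_set_scope.
Local Open Scope ring_scope.

Set Implicit Arguments.
Unset Strict Implicit.
Unset Printing Implicit Defensive.

(** The proof rests on one observation about the maps [w_i], i a word of length
n > 0.  Suppose that [w_i(A)] is covered by the other sets [w_j(A)], |j| = n.
The contraction [w_i] has a fixed point x in A ([contraction_fixpoint]); it lies
in [w_i(A)], hence in some [w_j(A)] with j <> i, so x has an address t that
starts with j.  Since [w_i x = x], prefixing i to an address of x gives again
an address of x ([address_prepend]), and the addresses t, it, iit, ... are
pairwise distinct because t does not start with i.  So x has infinitely many
addresses, a contradiction ([finite_addresses_Vset]).

For the strong Markov property at level n, let U be the set of the points x
such that, for all words i <> j of length n, [w_i x] is strictly closer to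
[w_i(A)] than to [w_j(A)].  It is open, and [w_i(U)], [w_j(U)] are disjoint,
since a common point would be closer to each of the two sets than to the other.
For density fix i <> j; a point x of A lies in some small piece [w_k(A)], and
membership in the set [Vset], applied to the longer word ik, gives z in A such
that [w_i w_k z] is in no other piece of level |ik|, hence not in [w_j(A)].
Thus [w_k z] is a point of A near x whose image by [w_i] is in [w_i(A)] but not
in the closed set [w_j(A)] ([nearer_dense]).  Finitely many pairs (i, j) occur,
and finite intersections of open sets dense in A are dense in A.

All this concerns an existing attractor, so Hutchinson's existence theorem is
needed too.  The attractor is obtained as the image of the compact space of
infinite words under the continuous coding map
[s |-> lim_n w_(s_0,...,s_(n-1))(p)] ([exists_attractor]).  The same coding
map, for a one-letter alphabet, yields the fixed points used above. *)

(** * Contractions *)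

Lemma geometric_lt (R : realType) (c K e : R) :
  0 <= c < 1 -> 0 < e -> exists n, c ^+ n * K < e.
Proof.
move=> /andP[c0 c1] e0.
have [K0|K0] := leP K 0.
  by exists 0%N; rewrite expr0 mul1r (le_lt_trans K0).
have cn : c ^+ n @[n --> \oo] --> (0 : R) by apply: cvg_expr; rewrite ger0_norm.
move/(@cvgr_dist_lt R R^o): cn => /(_ (e / K)).
rewrite divr_gt0// => /(_ isT)[n _ /(_ n (leqnn n))].
rewrite /mdist /= subr0 normrX (ger0_norm c0) => h.
by exists n; rewrite -ltr_pdivlMr.
Qed.

Definition contracts_by {R : realType} {X : metricType R} (c : R) (f : X -> X) :=
  forall x y, mdist (f x) (f y) <= c * mdist x y.

Lemma eq_of_geometric_dist (R : realType) (X : metricType R) (c K : R) (x y : X) :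
  0 <= c < 1 -> (forall n, mdist x y <= c ^+ n * K) -> x = y.
Proof.
move=> c01 h; apply: mdist_positivity.
apply/eqP; rewrite eq_le mdist_ge0 andbT leNgt; apply/negP => d0.
by have [n] := geometric_lt K c01 d0; rewrite ltNge h.
Qed.

(** The defining supremum is -oo on a singleton, where 0 serves as a ratio. *)
Lemma contracting_contracts_by (R : realType) (X : completeMetricType R)
    (f : X -> X) :
  contracting f -> exists2 c : R, 0 <= c < 1 & contracts_by c f.
Proof.
rewrite /contracting => f1.
have fub x y : x != y ->
    ((mdist (f x) (f y) / mdist x y)%:E <= contraction_ratio f)%E.
  by move=> xy; apply: ereal_sup_ubound; exists (x, y).
have H c : (contraction_ratio f <= c%:E)%E -> contracts_by c f.
  move=> fc x y; have [->|xy] := eqVneq x y; first by rewrite !mdistxx mulr0.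
  rewrite -ler_pdivrMr ?mdist_gt0// -lee_fin; exact: le_trans (fub _ _ xy) fc.
case E : (contraction_ratio f) f1 H => [r| |] //= r1 H.
- exists (Num.max 0 r); first by rewrite le_max lexx/= gt_max ltr01 -lte_fin.
  by apply: H; rewrite lee_fin le_max lexx orbT.
- by exists 0; [rewrite lexx ltr01|apply: H; rewrite leNye].
Qed.

Lemma common_ratio (R : realType) (X : completeMetricType R) (N : nat)
    (w : 'I_N -> X -> X) :
  (forall i, contracting (w i)) ->
  exists2 c : R, 0 <= c < 1 & forall i, contracts_by c (w i).
Proof.
move=> cw.
have /choice[c hc] : forall i, exists c : R, 0 <= c < 1 /\ contracts_by c (w i).
  by move=> i; have [c ? ?] := contracting_contracts_by (cw i); exists c.
exists (\big[Num.max/0]_i c i).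
  rewrite bigmax_ge_id/=; apply: bigmax_lt => // i _.
  by have [/andP[]] := hc i.
move=> i x y; apply: le_trans ((hc i).2 x y) _.
by rewrite ler_wpM2r ?mdist_ge0//; exact: le_bigmax.
Qed.

Lemma contracts_by_continuous (R : realType) (X : metricType R) (c : R)
    (f : X -> X) : 0 <= c < 1 -> contracts_by c f -> continuous f.
Proof.
move=> /andP[c0 c1] cf x; apply/cvgrPdist_lt => e e0.
have : \forall y \near x, mdist x y < e by apply: cvgr_dist_lt.
apply: filterS => y; apply: le_lt_trans.
by apply: le_trans (cf _ _) _; rewrite ler_piMl ?mdist_ge0 ?ltW.
Qed.

(** * Words *)

Section words.
Context {R : realType} {X : completeMetricType R} {N : nat}.
Context (w : 'I_N -> X -> X).

Lemma word_map_cat u v x :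
  word_map w (u ++ v) x = word_map w u (word_map w v x).
Proof. by elim: u => //= i u <-. Qed.

Lemma word_map_contracts_by c u : 0 <= c -> (forall i, contracts_by c (w i)) ->
  contracts_by (c ^+ size u) (word_map w u).
Proof.
move=> c0 cw; elim: u => [|i u IH] x y /=; first by rewrite expr0 mul1r.
rewrite exprS -mulrA; apply: le_trans (cw i _ _) _.
by rewrite ler_wpM2l.
Qed.

(** The word u followed by the infinite word s: the default value of [nth],
which depends on n, reads s beyond the end of u. *)
Definition prepend (u : seq 'I_N) (s : nat -> 'I_N) : nat -> 'I_N :=
  fun n => nth (s (n - size u)%N) u n.

Lemma mkseq_prepend u s m :
  mkseq (prepend u s) (size u + m) = u ++ mkseq s m.
Proof.
apply: (@eq_from_nth _ (s 0%N)) => [|k]; first by rewrite size_cat !size_mkseq.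
rewrite size_mkseq => km; rewrite nth_mkseq// nth_cat /prepend.
case: ltnP => ku; first exact: set_nth_default.
by rewrite nth_default// nth_mkseq// ltn_subLR.
Qed.

Lemma mkseq_prepend_size u s : mkseq (prepend u s) (size u) = u.
Proof. by rewrite -[size u]addn0 mkseq_prepend cats0. Qed.

Lemma prepend_inj u : injective (prepend u).
Proof.
move=> s t st; apply/funext => k.
have /(congr1 (drop (size u))) : u ++ mkseq s k.+1 = u ++ mkseq t k.+1.
  by rewrite -!mkseq_prepend st.
rewrite !drop_size_cat// => /(congr1 (nth (s k) ^~ k)).
by rewrite !nth_mkseq.
Qed.

Lemma prepend1_shift i s : prepend [:: i] s \o S = s.
Proof. by apply/funext => k; rewrite /prepend /= nth_nil subSS subn0. Qed.

Lemma mkseq_consE (s : nat -> 'I_N) n :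
  mkseq s n.+1 = s 0%N :: mkseq (s \o S) n.
Proof. by rewrite /mkseq /= (iotaDl 1 0 n) -map_comp. Qed.

End words.

(** * The coding map *)

Section coding.
Context {R : realType} {X : completeMetricType R} {N : nat}.
Context (w : 'I_N -> X -> X) (c : R).
Context (c01 : 0 <= c < 1) (cw : forall i, contracts_by c (w i)).

Let c0 : 0 <= c. Proof. by case/andP: c01. Qed.

(** If every [w i] moves p by at most M and has ratio c, then it maps the closed
ball of center p and radius M / (1 - c) into itself. *)
Lemma orbit_bounded (p : X) : exists K, forall u, mdist p (word_map w u p) <= K.
Proof.
pose M := \sum_i mdist p (w i p).
have Mge i : mdist p (w i p) <= M.
  by rewrite /M (bigD1 i)//= lerDl sumr_ge0// => j _; exact: mdist_ge0.
have M0 : 0 <= M by apply: sumr_ge0 => i _; exact: mdist_ge0.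
have c1 : 0 < 1 - c by case/andP: c01 => _; rewrite subr_gt0.
exists (M / (1 - c)); elim => [|i u IH] /=.
  by rewrite mdistxx divr_ge0// ltW.
apply: le_trans (metric_triangle p (w i p) _) _.
have -> : M / (1 - c) = M + c * (M / (1 - c)).
  by field; rewrite gt_eqF.
apply: lerD => //; apply: le_trans (cw _ _ _) _.
by rewrite ler_wpM2l.
Qed.

(** The map [code] is the coding map with base point p.  The limit is replaced by
the explicit rate K c^n, which determines [code] and from which its properties
follow without further passage to the limit. *)
Definition codes_from (p : X) (K : R) (code : (nat -> 'I_N) -> X) :=
  forall s n, mdist (word_map w (mkseq s n) p) (code s) <= c ^+ n * K.

(** The points [w_(s_0,...,s_(n-1))(p)] form a Cauchy sequence: the terms of index
at least n are images by one map of ratio c^n of points of the orbit of p, which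
is bounded. *)
Lemma exists_code (p : X) : exists K code, codes_from p K code.
Proof.
have [K hK] := orbit_bounded p; exists K.
suff /choice[code codeP] : forall s : nat -> 'I_N, exists x, forall n,
    mdist (word_map w (mkseq s n) p) x <= c ^+ n * K by exists code.
move=> s; pose u n := word_map w (mkseq s n) p.
have uS n m : (n <= m)%N -> mdist (u n) (u m) <= c ^+ n * K.
  move=> nm; rewrite /u -(subnKC nm) /mkseq iotaD map_cat word_map_cat.
  apply: le_trans (word_map_contracts_by _ c0 cw _ _) _.
  by rewrite size_map size_iota ler_wpM2l// exprn_ge0.
have /cauchy_cvg/cvg_ex[l ul] : cauchy (u @ \oo).
  apply: cauchy_exP => e e0; have [n cn] := geometric_lt K c01 e0.
  exists (u n), n => // m nm /=.
  by rewrite ballEmdist; apply: le_lt_trans cn; exact: uS.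
exists l => n; apply/ler_addgt0Pl => e e0.
have [m _ um] := cvgr_dist_lt ul e0.
have := um (maxn m n) (leq_maxl _ _); rewrite /= metric_sym => /ltW ume.
apply: le_trans (metric_triangle _ (u (maxn m n)) _) _.
by rewrite addrC lerD// uS// leq_maxr.
Qed.

(** This self-similarity makes the range of [code] invariant, and makes the code of
a constant word a fixed point. *)
Lemma code_shift p K code s : codes_from p K code ->
  code s = w (s 0%N) (code (s \o S)).
Proof.
move=> codeP; apply: (@eq_of_geometric_dist _ _ c (K + K)) => // n.
have K0 : 0 <= K.
  by have := codeP s 0%N; rewrite expr0 mul1r; apply: le_trans; exact: mdist_ge0.
have cn : c * (c ^+ n * K) <= c ^+ n * K.
  by rewrite ler_piMl ?mulr_ge0 ?exprn_ge0// ltW; case/andP: c01.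
have := codeP s n.+1; rewrite mkseq_consE /= exprS -mulrA => h1.
apply: le_trans (metric_triangle _ _ _) _; rewrite mulrDr; apply: lerD.
  by rewrite metric_sym; apply: le_trans h1 cn.
apply: le_trans (cw _ _ _) _; apply: le_trans cn.
by rewrite ler_wpM2l.
Qed.

Lemma code_near p K code s t n : codes_from p K code ->
  mkseq s n = mkseq t n -> mdist (code s) (code t) <= c ^+ n * (K + K).
Proof.
move=> codeP st; apply: le_trans (metric_triangle _ (word_map w (mkseq s n) p) _) _.
by rewrite mulrDr lerD//; [rewrite metric_sym|rewrite st].
Qed.

Let address_space := prod_topology (fun _ : nat => discrete_topology 'I_N).

Lemma code_continuous p K (code : address_space -> X) : codes_from p K code ->
  continuous code.
Proof.
move=> codeP s B /nbhs_ballP[e /= e0 eB].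
have [n cn] := geometric_lt (K + K) c01 e0.
have : nbhs s [set t : address_space | forall i : 'I_n, t (i : nat) = s (i : nat)].
  apply: (@filter_forall address_space _ _ (nbhs s) (nbhs_filter s)) => i.
  apply: (@proj_continuous _ (fun _ : nat => discrete_topology 'I_N) i s [set s i]).
  by rewrite nbhs_principalE.
apply: filterS => t ts; apply: eB; rewrite ballEmdist.
apply: le_lt_trans cn; apply: code_near codeP _.
apply/eq_in_map => k; rewrite mem_iota => /= kn.
by rewrite -(ts (Ordinal kn)).
Qed.

(** Hutchinson's theorem: the range of the coding map is compact by Tychonoff's
theorem and invariant by [code_shift]. *)
Lemma exists_attractor : (0 < N)%N -> exists A, is_attractor w A.
Proof.
move=> N0; have [K [code codeP]] := exists_code point.
exists (range code); split.
- by exists (code (fun=> Ordinal N0)); exists (fun=> Ordinal N0).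
- have -> : [set: nat -> 'I_N] =
      [set s : address_space | forall i : nat, [set: discrete_topology 'I_N] (s i)].
    by apply/seteqP; split.
  apply: (@continuous_compact address_space X code).
    exact/continuous_subspaceT/(code_continuous codeP).
  apply: (@tychonoff nat (fun=> discrete_topology 'I_N) (fun=> setT)) => _.
  by apply: finite_compact; exact: finite_finset.
- apply/seteqP; split=> [_ [s _ <-]|_ [i _ [_ [s _ <-] <-]]].
    exists (s 0%N) => //; exists (code (s \o S)) => //.
    by rewrite (code_shift s codeP).
  by exists (prepend [:: i] s) => //; rewrite (code_shift _ codeP) prepend1_shift.
Qed.

End coding.

(** The fixed point is the code of the only infinite word over one letter, with a
base point p in A; as a limit of iterates of p it stays in the closed set A. *)
Lemma contraction_fixpoint (R : realType) (X : completeMetricType R) (c : R)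
    (f : X -> X) (A : set X) :
  0 <= c < 1 -> contracts_by c f -> closed A -> A !=set0 ->
  (forall x, A x -> A (f x)) -> exists2 x, A x & f x = x.
Proof.
move=> c01 cf clA [p Ap] fA.
have cw (i : 'I_1) : contracts_by c ((fun=> f) i) by [].
have [K [code codeP]] := exists_code c01 cw p.
exists (code (fun=> ord0)); last by rewrite [RHS](code_shift c01 cw _ codeP).
apply: clA => B /nbhs_ballP[e /= e0 eB].
have [n cn] := geometric_lt K c01 e0.
exists (word_map (fun=> f) (mkseq (fun=> ord0 : 'I_1) n) p); split.
  by elim: (mkseq _ _) => //= i u; exact: fA.
by apply: eB; rewrite ballEmdist /= metric_sym; apply: le_lt_trans cn.
Qed.

(** * Addresses *)

Section addresses.
Context {R : realType} {X : completeMetricType R} {N : nat}.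
Context (w : 'I_N -> X -> X) (attr : is_attractor w (attractor w)).
Local Notation A := (attractor w).

Let imageA x : A x <-> exists i, exists2 a, A a & w i a = x.
Proof.
have [_ _ EA] := attr; split=> [|[i [a Aa <-]]].
  by rewrite {1}EA => -[i _ [a Aa <-]]; exists i, a.
by rewrite EA; exists i => //; exists a.
Qed.

Lemma attractor_word_map u a : A a -> A (word_map w u a).
Proof.
move=> Aa; elim: u => //= i u IH.
by apply/imageA; exists i, (word_map w u a).
Qed.

(** Iterate a choice, for each y in A, of a letter i and a point a of A such that
[w i a = y]. *)
Lemma attractor_address x : A x ->
  exists s, forall n, exists2 a, A a & word_map w (mkseq s n) a = x.
Proof.
move=> Ax; have [i0 _] := (imageA x).1 Ax.
have /choice[f fP] : forall y, exists q : 'I_N * X, A y -> A q.2 /\ w q.1 q.2 = y.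
  (* The letter i0 is a default value for the points outside A. *)
  move=> y; have [/imageA[i [a Aa <-]]|nAy] := pselect (A y); first by exists (i, a).
  by exists (i0, y).
pose y n := iter n (snd \o f) x; exists (fun n => (f (y n)).1) => n.
suff [Ay yx] : A (y n) /\ word_map w (mkseq (fun n => (f (y n)).1) n) (y n) = x.
  by exists (y n).
elim: n => [|n [Ay yx]]; first by split.
have [Afy wy] := fP _ Ay; split=> //.
by rewrite mkseqS -cats1 word_map_cat -[RHS]yx /= wy.
Qed.

Lemma attractor_tuple n x : A x ->
  exists u : n.-tuple 'I_N, exists2 a, A a & word_map w u a = x.
Proof.
by move=> /attractor_address[s /(_ n)[a Aa ax]]; exists [tuple of mkseq s n], a.
Qed.

Lemma exists_address x : A x -> exists s, is_address w s x.
Proof.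
move=> /attractor_address[s sx]; exists s => n _.
by have [a Aa ax] := sx n; exists a.
Qed.

(** The sets [w_(s_0,...,s_(n-1))(A)] decrease with n, so the condition for a
length n of the prefixed word follows from the one for the length n + |u|. *)
Lemma address_prepend u s x :
  is_address w s x -> is_address w (prepend u s) (word_map w u x).
Proof.
move=> sx n n0; have [a Aa ax] := sx n n0.
pose v := map (prepend u s) (iota n (size u)).
exists (word_map w v a); first exact: attractor_word_map.
have E : mkseq (prepend u s) n ++ v = mkseq (prepend u s) (size u + n).
  by rewrite addnC /mkseq iotaD map_cat.
by rewrite -word_map_cat E mkseq_prepend word_map_cat ax.
Qed.

End addresses.

(** Otherwise the iterates [f^k t] would be pairwise distinct elements of S. *)
Lemma finite_injective_onto (T : Type) (S : set T) (f : T -> T) t :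
  finite_set S -> injective f -> (forall x, S x -> S (f x)) -> S t ->
  exists x, f x = t.
Proof.
move=> finS finj fS St; apply: contrapT => nt.
pose g k := iter k f t.
have ginj : injective g.
  elim=> [|k IH] [|l] //= E; last by rewrite (IH l)//; exact: finj.
    by case: nt; exists (g l).
  by case: nt; exists (g k).
have := finite_preimage (in2W ginj) finS.
have -> : g @^-1` S = setT.
  by apply/seteqP; split=> // k _; rewrite /preimage/=; elim: k => //= k; exact: fS.
exact: infinite_nat.
Qed.

(** Prefixing i is an injection of the finite set of addresses of a fixed point of
[w_i] into itself, hence onto; so all these addresses start with i, and the
fixed point is in no other [w_j(A)]. *)
Lemma finite_addresses_Vset (R : realType) (X : completeMetricType R) (N : nat)
    (w : 'I_N -> X -> X) n (i : n.-tuple 'I_N) :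
  (forall i, contracting (w i)) -> is_attractor w (attractor w) -> (0 < n)%N ->
  (forall x, attractor w x -> finite_set (addresses w x)) ->
  ~ (word_map w i @` attractor w `<=`
     \bigcup_(j in [set j : n.-tuple 'I_N | j != i]) (word_map w j @` attractor w)).
Proof.
move=> cw attr n0 fin sub; have [A0 cA _] := attr.
have [c c01 wc] := common_ratio cw; have /andP[c0 c1] := c01.
have ci : contracts_by (c ^+ n) (word_map w i).
  by have := word_map_contracts_by i c0 wc; rewrite size_tuple.
have cn01 : 0 <= c ^+ n < 1 by rewrite exprn_ge0// exprn_ilt1// -lt0n.
have clA : closed (attractor w) := compact_closed (@metric_hausdorff _ X) cA.
have [x Ax ix] := contraction_fixpoint cn01 ci clA A0 (attractor_word_map attr i).
have [j /= ji [a Aa ja]] : (\bigcup_(j in [set j : n.-tuple 'I_N | j != i])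
    (word_map w j @` attractor w)) x by apply: sub; exists x.
have [s sa] := exists_address attr Aa.
have jx : addresses w x (prepend j s) by rewrite -ja; exact: address_prepend.
have ix_addr t : addresses w x t -> addresses w x (prepend i t).
  by move=> tx; rewrite -ix; exact: address_prepend.
have [t it] := finite_injective_onto (fin x Ax) (@prepend_inj _ i) ix_addr jx.
have prefix (k : n.-tuple 'I_N) u : mkseq (prepend k u) n = k.
  by rewrite -[X in mkseq _ X](size_tuple k) mkseq_prepend_size.
by move/eqP: ji; apply; apply: val_inj; rewrite /= -(prefix j s) -it prefix.
Qed.

(** * The strong Markov property *)

Section closer.
Context {R : realType} {X : metricType R}.

(** A margin e and a witness s in S stand for the inequality d(p, S) < d(p, T);
this avoids the distance functions to S and T and their infima. *)
Definition closer (S T : set X) : set X :=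
  [set p | exists2 s, S s &
    exists2 e, 0 < e & forall t, T t -> mdist p s + e <= mdist p t].

Lemma closer_open S T : open (closer S T).
Proof.
rewrite openE => p [s Ss [e e0 h]]; apply/nbhs_ballP.
exists (e / 4); first by rewrite /= divr_gt0.
move=> q; rewrite ballEmdist /= => pq; exists s => //.
exists (e / 2); first by rewrite divr_gt0.
move=> t Tt; have := h t Tt.
have := metric_triangle q p s; have := metric_triangle p q t.
rewrite (metric_sym q p); lra.
Qed.

Lemma closer_disjoint S T : closer S T `&` closer T S = set0.
Proof.
rewrite -subset0 => p [[s Ss [e e0 h]] [t Tt [e' e'0 h']]].
by have := h t Tt; have := h' s Ss; lra.
Qed.

Lemma closer_mem S T s : closed T -> S s -> ~ T s -> closer S T s.
Proof.
move=> clT Ss nTs; exists s => //.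
have /nbhs_ballP[e /= e0 eT] : nbhs s (~` T).
  by apply: open_nbhs_nbhs; split => //; exact: closed_openC.
exists e => // t Tt; rewrite mdistxx add0r leNgt; apply/negP => se.
by apply: (eT t) => //; rewrite ballEmdist.
Qed.

End closer.

Definition open_dense_in {T : topologicalType} (A U : set T) :=
  open U /\ A `<=` closure (U `&` A).

Lemma open_dense_inI (T : topologicalType) (A U V : set T) :
  open_dense_in A U -> open_dense_in A V -> open_dense_in A (U `&` V).
Proof.
move=> [oU dU] [oV dV]; split; first exact: openI.
move=> x Ax B Bx; have [y [[Uy Ay] By]] := dU x Ax _ (nbhs_interior Bx).
have UBy : nbhs y (U `&` B) by apply: filterI => //; exact: open_nbhs_nbhs.
by have [z [[Vz Az] [Uz Bz]]] := dV y Ay _ UBy; exists z.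
Qed.

Lemma open_dense_in_forall (T : topologicalType) (A : set T) (I : finType)
    (U : I -> set T) :
  (forall i, open_dense_in A (U i)) ->
  open_dense_in A [set x | forall i, U i x].
Proof.
move=> dU.
have -> : [set x | forall i, U i x] = \big[setI/setT]_i U i.
  rewrite -bigcap_seq; apply/seteqP; split=> x Ux i; first by move=> _; exact: Ux.
  by apply: Ux; rewrite /= mem_index_enum.
apply: big_ind => //; last by move=> *; exact: open_dense_inI.
by split; [exact: openT|rewrite setTI; exact: subset_closure].
Qed.

Lemma compact_mdist_bounded (R : realType) (X : metricType R) (A : set X) :
  compact A -> exists M, forall a b, A a -> A b -> mdist a b <= M.
Proof.
move=> cA; have [->|/set0P[p Ap]] := eqVneq A set0; first by exists 0.
have : \forall M \near +oo%R, A `<=` [set x | mdist p x <= M].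
  (* Near each x the bound holds uniformly for all large M; compactness of A makes
     the threshold for M uniform. *)
  apply: (compact_near_coveringP A).1 => // x Ax.
  exists (ball x 1, [set M | mdist p x + 1 <= M]).
    by split; [exact: nbhsx_ballx|apply: nbhs_pinfty_ge; exact: num_real].
  move=> [y M] /= [xy pM]; apply: le_trans (metric_triangle p x y) _.
  by apply: le_trans pM; rewrite lerD2l ltW//; rewrite ballEmdist in xy.
move=> /(pinfty_ex_ge (num_real 0))[M _ AM].
exists (M + M) => a b Aa Ab; apply: le_trans (metric_triangle a p b) _.
by rewrite lerD//; [rewrite metric_sym|]; exact: AM.
Qed.

Section markov.
Context {R : realType} {X : completeMetricType R} {N : nat}.
Context (w : 'I_N -> X -> X) (attr : is_attractor w (attractor w)).
Context (cw : forall i, contracting (w i)).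
Local Notation A := (attractor w).

Let clA : closed A.
Proof.
by have [_ cA _] := attr; exact: compact_closed (@metric_hausdorff _ X) cA.
Qed.

Lemma word_map_continuous u : continuous (word_map w u).
Proof.
have [c c01 wc] := common_ratio cw.
elim: u => [|i u IH] x; first exact: cvg_id.
apply: continuous_comp; first exact: IH.
exact: contracts_by_continuous (wc i) _.
Qed.

Lemma word_image_closed u : closed (word_map w u @` A).
Proof.
have [_ cA _] := attr; apply: compact_closed; first exact: metric_hausdorff.
by apply: continuous_compact => //; exact/continuous_subspaceT/word_map_continuous.
Qed.

(** Near x in A there is a piece [w_k(A)], and the piece [w_(ik)(A)] has a point
outside all the other pieces of its level; these cover [w_j(A)], as j is not a
prefix of ik. *)
Lemma nearer_dense n (i j : n.-tuple 'I_N) : i != j ->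
  (forall m, (0 < m)%N -> Vset m w) -> (0 < n)%N ->
  open_dense_in A
    (word_map w i @^-1` closer (word_map w i @` A) (word_map w j @` A)).
Proof.
move=> ij V n0; split.
  by apply: open_comp (closer_open _ _) => x _; exact: word_map_continuous.
move=> x Ax B /nbhs_ballP[e /= e0 eB].
have [c c01 wc] := common_ratio cw; have /andP[c0 c1] := c01.
have [_ cA _] := attr; have [M AM] := compact_mdist_bounded cA.
have [L cL] := geometric_lt M c01 e0.
have [k [a Aa ax]] := attractor_tuple attr L Ax.
have nL0 : (0 < n + L)%N by rewrite addn_gt0 n0.
have [_ /(_ (cat_tuple i k))] := V _ nL0.
move=> /existsNP[q /not_implyP[[z Az <-] nz]].
rewrite /= word_map_cat in nz.
exists (word_map w k z); split; last first.
  apply: eB; rewrite ballEmdist /= -ax; apply: le_lt_trans cL.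
  apply: le_trans (word_map_contracts_by _ c0 wc _ _) _.
  by rewrite size_tuple ler_wpM2l ?exprn_ge0//; exact: AM.
split; last exact: attractor_word_map.
apply: closer_mem; first exact: word_image_closed.
  by exists (word_map w k z) => //; exact: attractor_word_map.
move=> [b Ab jb]; apply: nz.
have [k' [b' Ab' b'b]] := attractor_tuple attr L Ab.
exists (cat_tuple j k'); last by exists b' => //=; rewrite word_map_cat b'b.
apply: contra ij => /eqP/(congr1 val)/eqP /=.
by rewrite eqseq_cat ?size_tuple// => /andP[/eqP/val_inj->].
Qed.

Lemma Vset_strong_Markov :
  (forall m, (0 < m)%N -> Vset m w) -> strong_Markov_property w.
Proof.
move=> V n n0.
pose D (p : n.-tuple 'I_N * n.-tuple 'I_N) := if p.1 == p.2 then setT else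
  word_map w p.1 @^-1` closer (word_map w p.1 @` A) (word_map w p.2 @` A).
have [oU dU] : open_dense_in A [set x | forall p, D p x].
  apply: open_dense_in_forall => -[i j]; rewrite /D /=; case: ifPn => [_|ij].
    by split; [exact: openT|rewrite setTI; exact: subset_closure].
  exact: nearer_dense.
exists [set x | forall p, D p x]; split=> //.
  apply/seteqP; split=> //.
  by rewrite [X in _ `<=` X](closure_id A).1//; apply: closureS; exact: subIsetr.
move=> i j ij; rewrite -subset0 => _ [[x Ux <-] [y Uy yx]].
have := Ux (i, j); have := Uy (j, i).
rewrite /D /= (eq_sym j i) (negPf ij) /preimage /= yx.
move=> Dj Di.
have : (closer (word_map w i @` A) (word_map w j @` A) `&`
        closer (word_map w j @` A) (word_map w i @` A)) (word_map w i x) by split.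
by rewrite closer_disjoint.
Qed.

End markov.

Theorem proposition4 (R : realType) (X : completeMetricType R) (N : nat)
    (w : 'I_N -> X -> X) :
  (0 < N)%N ->
  (forall i : 'I_N, contracting_homeo (w i)) ->
  (forall x : X, attractor w x -> finite_set (addresses w x)) ->
  (\bigcap_(n in [set n : nat | (0 < n)%N]) Vset n) w /\
  strong_Markov_property w.
Proof.
move=> N0 hw fin.
have cw i : contracting (w i) by have [] := hw i.
have [c c01 wc] := common_ratio cw.
have attr : is_attractor w (attractor w).
  exact: (xgetPex set0 (exists_attractor c01 wc N0)).
have V m : (0 < m)%N -> Vset m w.
  by move=> m0; split=> // i; exact: finite_addresses_Vset.
by split=> //; exact: Vset_strong_Markov.
Qed.
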